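(* Let $H$ and $N$ be closed subgroups of a compact group $G$ such that $N\le H$ and $N$ is normal in $G$. Then $d(H,G)\le d(H/N,G/N)\,d(N)$. Moreover, equality holds if $N\cap[H,G]$ is trivial.
   Context: For a compact group $X$, $\mu_X$ denotes its normalized Haar measure (for $N$ closed normal, $G/N$ and $H/N$ are compact groups with their own normalized Haar measures). Commutator $[x,y]=x^{-1}y^{-1}xy$; $[H,G]$ is the subgroup generated by all $[h,g]$ with $h\in H$, $g\in G$. The commutativity degree of a compact group $X$ is $d(X)=(\mu_X\times\mu_X)(\{(x,y)\in X\times X: [x,y]=1\})$. For a closed subgroup $H$ of a compact group $L$, the relative commutativity degree is $d(H,L)=(\mu_H\times\mu_L)(\{(h,g)\in H\times L: [h,g]=1\})$. *)

(* Defs.v *)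
From HB Require Import structures.
From mathcomp Require Import all_boot all_order all_algebra.
From mathcomp Require Import all_classical all_reals all_analysis.

Set Implicit Arguments.
Unset Strict Implicit.
Unset Printing Implicit Defensive.

Import Order.TTheory GRing.Theory Num.Theory.
Local Open Scope classical_set_scope.
Local Open Scope ring_scope.

Record compact_group (T : ptopologicalType) := CompactGroup {
  cg_mul : T -> T -> T;
  cg_inv : T -> T;
  cg_one : T;
  cg_mulA : forall x y z, cg_mul x (cg_mul y z) = cg_mul (cg_mul x y) z;
  cg_mul1 : forall x, cg_mul cg_one x = x;
  cg_mulV : forall x, cg_mul (cg_inv x) x = cg_one;
  cg_cont : continuous (fun p : T * T => cg_mul p.1 (cg_inv p.2));
  cg_compact : compact [set: T];
  cg_hausdorff : hausdorff_space T
}.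

Section GroupNotions.
Context {T : ptopologicalType} (G : compact_group T).
Local Notation "x * y" := (cg_mul G x y).
Local Notation "x ^-1" := (cg_inv G x).
Local Notation "1" := (cg_one G).

Definition gcomm (x y : T) : T := x^-1 * (y^-1 * (x * y)).

Definition is_subgroup (H : set T) : Prop :=
  H 1 /\ (forall x y, H x -> H y -> H (x * y)) /\ (forall x, H x -> H (x^-1)).

Definition closed_subgroup (H : set T) : Prop := is_subgroup H /\ closed H.

Definition normal_subgroup (N : set T) : Prop :=
  is_subgroup N /\ forall x g, N x -> N (g^-1 * (x * g)).

Definition gen_subgroup (A : set T) : set T :=
  \bigcap_(K in [set K | is_subgroup K /\ A `<=` K]) K.

Definition comm_subgroup (H K : set T) : set T :=
  gen_subgroup [set gcomm h k | h in H & k in K].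

End GroupNotions.

Definition Borel (T : ptopologicalType) := g_sigma_algebraType (@open T).

(** [mu] is the normalized Haar measure of the closed subgroup [H] of [G],
    regarded as a (Radon) Borel probability measure on [G] concentrated on [H]:
    mu H = 1 = mu setT, mu is invariant under left translation by elements of H,
    and mu is inner regular by compact sets. *)
Definition haar_on {R : realType} {T : ptopologicalType} (G : compact_group T)
    (H : set T) (mu : {measure set (Borel T) -> \bar R}) : Prop :=
  [/\ mu [set: Borel T] = 1%E,
      mu (H : set (Borel T)) = 1%E,
      (forall h (A : set (Borel T)), H h -> measurable A ->
          mu (cg_mul G h @` A) = mu A) &
      (forall A : set (Borel T), measurable A ->
          mu A = ereal_sup [set mu K | K in [set K : set T | compact K /\ K `<=` A]])].

Definition rel_comm_degree {R : realType} {T : ptopologicalType} (G : compact_group T)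
    (muH muK : {measure set (Borel T) -> \bar R}) : \bar R :=
  (muH \x muK)%E [set p : Borel T * Borel T | gcomm G p.1 p.2 = cg_one G].

(** [pi : T -> Q] presents the compact group [Q] as the quotient G/N:
    a continuous, open, surjective group homomorphism with kernel N. *)
Definition is_quotient_map {T Q : ptopologicalType} (G : compact_group T)
    (GQ : compact_group Q) (N : set T) (pi : T -> Q) : Prop :=
  [/\ continuous pi,
      (forall U : set T, open U -> open (pi @` U)),
      (forall q : Q, exists x, pi x = q),
      (forall x y, pi (cg_mul G x y) = cg_mul GQ (pi x) (pi y)) &
      (forall x, pi x = cg_one GQ <-> N x)].

(* Main.v *)
(** Write [C x] for the centralizer of [x], [phi x] for the measure of the
    centralizer of [pi x] in [G/N], and [la] for the measure [phi . muH].
    If [la'] is a measure invariant under right translation by [N], averaging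
    over [N] gives [la' C = muN (C `&` N) * la' (C N)] for every closed
    subgroup [C].  With [la' = muG] this yields
    [muG (C x) <= muN (C x) * phi x], hence
    [d(H, G) <= \int[la]_x muN (C x) = \int[muN]_m la (C m)], and with
    [la' = la] the last integrand is at most [muN (C m) * la G].  Finally
    [la G = d(H/N, G/N)] since the image of [muH] in [G/N] is the Haar measure
    of [H/N].  Both inequalities come from [C N] being possibly smaller than
    the preimage of the centralizer of [pi x], resp. than [H]; triviality of
    [N `&` [H, G]] excludes this.

    Closed subsets of [G * G] need not be measurable for the product of the
    Borel sigma-algebras, so exchanging the order of integration uses inner
    regularity: a closed set is contained in a product-measurable set with
    almost everywhere the same section measures. *)

Require Import Defs.
From HB Require Import structures.
From mathcomp Require Import all_boot all_order all_algebra finmap.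
From mathcomp Require Import all_classical all_reals all_analysis.
From mathcomp Require Import measurable_realfun lra.
Import Order.TTheory GRing.Theory Num.Theory.
Local Open Scope classical_set_scope.
Local Open Scope ring_scope.

Set Implicit Arguments.
Unset Strict Implicit.
Unset Printing Implicit Defensive.

(** * Finite inner regular Borel measures *)

Section RadonMeasures.
Context {R : realType}.
Local Open Scope ereal_scope.

Lemma closed_Borel_measurable (X : ptopologicalType) (A : set X) :
  closed A -> measurable (A : set (Borel X)).
Proof.
move=> cA; rewrite -(setCK A); apply: measurableC.
by apply: sub_sigma_algebra; rewrite /= openC.
Qed.

Lemma open_Borel_measurable (X : ptopologicalType) (A : set X) :
  open A -> measurable (A : set (Borel X)).
Proof. exact: sub_sigma_algebra. Qed.

Lemma continuous_Borel_measurable (X Y : ptopologicalType) (f : X -> Y) :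
  continuous f -> measurable_fun [set: Borel X] (f : Borel X -> Borel Y).
Proof.
move=> cf; apply: (@measurability _ _ _ (Borel Y) _ _ (@open Y)) => //.
move=> _ [U oU <-]; rewrite setTI; apply: open_Borel_measurable.
by apply: open_comp => // x _; exact: cf.
Qed.

Definition inner_regular (X : ptopologicalType)
    (mu : {measure set (Borel X) -> \bar R}) : Prop :=
  forall A : set (Borel X), measurable A ->
    mu A = ereal_sup [set mu K | K in [set K : set X | compact K /\ K `<=` A]].

Lemma fin_num_measure_setT {d} {X : measurableType d}
    (mu : {measure set X -> \bar R}) (A : set X) :
  mu setT < +oo -> measurable A -> mu A \is a fin_num.
Proof.
move=> muT mA; rewrite ge0_fin_numE//; apply: le_lt_trans muT.
by apply: le_measure; rewrite ?inE.
Qed.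

Lemma inner_approx (X : ptopologicalType) (mu : {measure set (Borel X) -> \bar R})
    (A : set (Borel X)) (e : R) :
  mu setT < +oo -> inner_regular mu -> measurable A -> (0 < e)%R ->
  exists K : set X, [/\ compact K, K `<=` A & mu A < mu K + e%:E].
Proof.
move=> muT rmu mA e0; have Afin := fin_num_measure_setT muT mA.
have := Afin; rewrite {1}(rmu _ mA) => /(ub_ereal_sup_adherent e0).
rewrite -(rmu _ mA) => -[_ [K [cK KA] <-]] h; exists K; split => //.
by rewrite -lteBlDr.
Qed.

Lemma inner_regular_intro (X : ptopologicalType)
    (mu : {measure set (Borel X) -> \bar R}) : hausdorff_space X ->
  (forall (A : set (Borel X)) (e : R), measurable A -> (0 < e)%R ->
    exists K : set X, [/\ compact K, K `<=` A & mu A <= mu K + e%:E]) ->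
  inner_regular mu.
Proof.
move=> hX h A mA; apply/eqP; rewrite eq_le; apply/andP; split.
- apply/lee_addgt0Pr => e /(h A e mA)[K [cK KA le]].
  apply: le_trans le _; rewrite leeD2r//; apply: ereal_sup_ubound.
  by exists K.
- apply: ub_ereal_sup => _ [K [cK KA] <-]; apply: le_measure; rewrite ?inE//.
  by apply: closed_Borel_measurable; exact: compact_closed.
Qed.

(** Complements of compact sets are open here, so approximating the complement of [A] from inside
    approximates [A] from outside; finiteness of [mu] allows the subtraction. *)
Lemma outer_approx (X : ptopologicalType) (mu : {measure set (Borel X) -> \bar R})
    (A : set (Borel X)) (e : R) : hausdorff_space X ->
  mu setT < +oo -> inner_regular mu -> measurable A -> (0 < e)%R ->
  exists U : set X, [/\ open U, A `<=` U & mu U < mu A + e%:E].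
Proof.
move=> hX muT rmu mA e0.
have [K [cK KA lt]] := inner_approx muT rmu (measurableC mA) e0.
have clK : closed K by exact: compact_closed.
have mK := closed_Borel_measurable clK.
exists (~` K); split; first by rewrite openC.
  by move=> x Ax /KA.
have muC (B : set (Borel X)) : measurable B -> mu (~` B) = mu setT - mu B.
  move=> mB; rewrite -setTD measureD// ?setTI//.
move: lt; rewrite !muC//.
have := fin_num_measure_setT muT mK; have := fin_num_measure_setT muT mA.
have := fin_num_measure_setT muT (@measurableT _ (Borel X)).
move: (mu setT) (mu A) (mu K) => [t||] // [a||] // [k||] //= _ _ _.
by rewrite -!EFinD !lte_fin => h; lra.
Qed.

(** A compact [K] inside the preimage of [A] has a compact image inside [A], and the preimage of
    that image still contains [K]. *)
Lemma inner_regular_pushforward (X Y : ptopologicalType) (f : X -> Y)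
    (mu : {measure set (Borel X) -> \bar R})
    (nu : {measure set (Borel Y) -> \bar R}) :
  hausdorff_space X -> hausdorff_space Y -> continuous f ->
  (forall A, measurable A -> nu A = mu (f @^-1` A)) ->
  mu setT < +oo -> inner_regular mu -> inner_regular nu.
Proof.
move=> hX hY cf nuE muT rmu; apply: inner_regular_intro => // A e mA e0.
have mf := continuous_Borel_measurable cf.
have mpre (B : set (Borel Y)) :
    measurable B -> measurable (f @^-1` B : set (Borel X)).
  by move=> mB; rewrite -[X in measurable X]setTI; exact: mf.
have [K [cK KA lt]] := inner_approx muT rmu (mpre _ mA) e0.
have cfK : compact (f @` K).
  by apply: continuous_compact => //; apply: continuous_subspaceT.
have mfK : measurable (f @` K : set (Borel Y)).
  by apply: closed_Borel_measurable; exact: compact_closed.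
exists (f @` K); split => //; first by move=> _ [x Kx <-]; exact: KA.
rewrite !nuE//; apply: le_trans (ltW lt) _; rewrite leeD2r//.
apply: le_measure; rewrite ?inE//.
- by apply: closed_Borel_measurable; exact: compact_closed.
- exact: mpre.
- by move=> x Kx; exists x.
Qed.

End RadonMeasures.

(** * Fubini for closed subsets of a product of two compact spaces *)

Section ClosedFubini.
Context {R : realType}.
Local Open Scope ereal_scope.

(** The product measure constructions expect a bundled finite measure; a bare measure of finite
    total mass is repackaged as one without changing its values. *)
Lemma finite_measure_of {d} {X : measurableType d}
    (mu : {measure set X -> \bar R}) : mu setT < +oo ->
  exists nu : {finite_measure set X -> \bar R}, nu = mu :> (set X -> \bar R).
Proof.
move=> muT; have finm : fin_num_fun mu.
  by move=> A mA; exact: fin_num_measure_setT.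
pose H1 := isFinite.Build _ _ _ _ finm.
have sf : sigma_finite setT mu by apply: fin_num_fun_sigma_finite; rewrite ?measure0.
pose H2 := isSFinite.Build _ _ _ _ (sfinite_measure_sigma_finite sf).
pose H3 := isSigmaFinite.Build _ _ _ _ sf.
by exists (HB.pack_for (FiniteMeasure.type X R) (Measure.sort mu) H1 H2 H3).
Qed.

Lemma xsection_setE (X Y : Type) (V : set (X * Y)) (x : X) :
  xsection V x = [set y | V (x, y)].
Proof. by apply/seteqP; split => y; rewrite /xsection/= inE. Qed.

Lemma ysection_setE (X Y : Type) (V : set (X * Y)) (y : Y) :
  ysection V y = [set x | V (x, y)].
Proof. by apply/seteqP; split => x; rewrite /ysection/= inE. Qed.

Lemma closed_section (X Y : topologicalType) (E : set (X * Y)) (x : X) :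
  closed E -> closed [set y | E (x, y)].
Proof.
move=> cE; apply: (@preimage_closed _ _ (fun y => (x, y)) E) => // y _.
by apply: cvg_pair => //; exact: cvg_cst.
Qed.

Lemma closed_swap (X Y : topologicalType) (E : set (X * Y)) :
  closed E -> closed [set p : Y * X | E (p.2, p.1)].
Proof.
move=> cE; apply: (@preimage_closed _ _ (fun p : Y * X => (p.2, p.1)) E) => //.
by move=> p _; apply: cvg_pair; [exact: cvg_snd|exact: cvg_fst].
Qed.

(** Each [y] outside [U] has, together with [x], a box missing [E]; compactness of the complement of
    [U] extracts one neighbourhood of [x] that serves all such [y]. *)
Lemma tube (X Y : ptopologicalType) (E : set (X * Y)) (x : X) (U : set Y) :
  compact [set: Y] -> closed E -> open U -> (forall y, E (x, y) -> U y) ->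
  exists W : set X, [/\ open W, W x & forall x' y, W x' -> E (x', y) -> U y].
Proof.
move=> cY cE oU EU.
have cU : compact (~` U).
  by apply: (subclosed_compact _ cY) => //; rewrite closedC.
have : nbhs x (fun x' => ~` U `<=` [set y | ~ E (x', y)]).
  move/compact_near_coveringP : cU; apply => y Uy.
  have : nbhs (x, y) (~` E).
    by apply: open_nbhs_nbhs; split; [rewrite openC|move=> /EU].
  by case=> -[A B] [/= xA yB] AB; exists (B, A) => // -[y' x'] [? ?]; exact: AB.
rewrite nbhsE => -[W [oW Wx] WP]; exists W; split => // x' y /WP h Exy.
by apply: contrapT => /h.
Qed.

Section one_measure.
Variables (X Y : ptopologicalType) (mu : {measure set (Borel Y) -> \bar R}).
Hypotheses (cY : compact [set: Y]) (hY : hausdorff_space Y).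
Hypotheses (muT : mu setT < +oo) (rmu : inner_regular mu).
Variable E : set (X * Y).
Hypothesis cE : closed E.

Lemma measurable_section (x : X) :
  measurable ([set y | E (x, y)] : set (Borel Y)).
Proof. by apply: closed_Borel_measurable; exact: closed_section. Qed.

(** Outer regularity yields an open [U] around the section at [x], still of measure below [c]; the
    tube lemma keeps nearby sections inside the same [U]. *)
Lemma section_outer (x : X) (c : R) : mu [set y | E (x, y)] < c%:E ->
  exists W U, [/\ open W, W x, open U, mu U < c%:E &
    forall x' y, W x' -> E (x', y) -> U y].
Proof.
move=> xc; have mEx := measurable_section x.
have fE := fin_num_measure_setT muT mEx.
have e0 : (0 < c - fine (mu [set y | E (x, y)]))%R.
  by rewrite subr_gt0 -lte_fin fineK.
have [U [oU EU lt]] := outer_approx hY muT rmu mEx e0.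
have [W [oW Wx WP]] := tube cY cE oU EU.
exists W, U; split => //; apply: lt_le_trans lt _.
by rewrite -{1}(fineK fE) -EFinD lee_fin subrKC.
Qed.

(** Upper semicontinuity of the section measure. It makes this function Borel even when [E] is not
    measurable for the product sigma-algebra. *)
Lemma open_measure_section_lt (c : R) :
  open [set x | mu [set y | E (x, y)] < c%:E].
Proof.
rewrite openE => x /= /section_outer[W [U [oW Wx oU Uc WU]]].
rewrite /interior nbhsE; exists W => // x' Wx' /=; apply: le_lt_trans Uc.
apply: le_measure; rewrite ?inE.
- exact: measurable_section.
- exact: open_Borel_measurable.
- by move=> y; exact: WU.
Qed.

Lemma measurable_fun_section :
  measurable_fun [set: Borel X] (fun x => mu [set y | E (x, y)]).
Proof.
apply: (measurability _ (ErealGenInftyO.measurableE R)).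
move=> /= _ [_ [a ->]] <-; rewrite setTI; apply: open_Borel_measurable.
rewrite (_ : _ @^-1` _ = [set x | mu [set y | E (x, y)] < a%:E]).
  exact: open_measure_section_lt.
by apply/seteqP; split => x /=; rewrite in_itv.
Qed.

End one_measure.

Lemma dense_seq : exists q : nat -> R,
  forall x y, (x < y)%R -> exists k, (x < q k < y)%R.
Proof.
(* The rationals, enumerated through their codes; a number that codes none is sent to [0], which
   cannot spoil density. *)
exists (fun k => ratr (odflt 0%R (choice.unpickle k))) => x y /rat_in_itvoo[r].
by rewrite in_itv/= => rxy; exists (choice.pickle r); rewrite choice.pickleK.
Qed.

Section two_measures.
Variables (X Y : ptopologicalType).
Variables (nu : {measure set (Borel X) -> \bar R}).
Variables (mu : {measure set (Borel Y) -> \bar R}).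
Hypotheses (cX : compact [set: X]) (hX : hausdorff_space X).
Hypotheses (cY : compact [set: Y]) (hY : hausdorff_space Y).
Hypotheses (nuT : nu setT < +oo) (rnu : inner_regular nu).
Hypotheses (muT : mu setT < +oo) (rmu : inner_regular mu).
Variable E : set (X * Y).
Hypothesis cE : closed E.

Let O (c : R) : set (Borel X) := [set x | mu [set y | E (x, y)] < c%:E].

Let mO c : measurable (O c).
Proof. by apply: open_Borel_measurable; exact: open_measure_section_lt. Qed.

(* Inner regularity leaves a compact [B] on which finitely many tubes
   [W `*` U] with [mu U < c] cover [E]; [V] forbids leaving any of them. *)
Lemma section_cover (c e : R) : (0 < e)%R ->
  exists VB : set (Borel X * Borel Y) * set (Borel X),
  [/\ measurable VB.1, E `<=` VB.1, measurable VB.2,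
     nu (O c `\` VB.2) <= e%:E &
     forall x, VB.2 x -> mu [set y | VB.1 (x, y)] <= c%:E].
Proof.
move=> e0.
have [B [cB BO lt]] := inner_approx nuT rnu (mO c) e0.
have /choice[WU WUP] (x : X) : exists WU : set X * set Y,
    B x -> [/\ open WU.1, WU.1 x, open WU.2, mu WU.2 < c%:E &
    forall x' y, WU.1 x' -> E (x', y) -> WU.2 y].
  have [Bx|nBx] := pselect (B x); last by exists (set0, set0).
  have [W [U ?]] := section_outer cY hY muT rmu cE (BO _ Bx).
  by exists (W, U).
have : compact B by [].
rewrite compact_cover => /(_ X B (fun x => (WU x).1)) [|x Bx|D DB BD].
- by move=> x Bx; have [] := WUP x Bx.
- by exists x => //; have [] := WUP x Bx.
have mB : measurable (B : set (Borel X)).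
  by apply: closed_Borel_measurable; exact: compact_closed.
have DP x : x \in D -> B x by move=> /DB; rewrite inE.
pose V : set (Borel X * Borel Y) :=
  ~` \big[setU/set0]_(x <- D) ((WU x).1 `*` ~` (WU x).2).
have mV : measurable V.
  apply/measurableC; rewrite big_seq; apply: bigsetU_measurable => x /DP Bx.
  have [oW _ oU _ _] := WUP x Bx; apply: measurableX.
    exact: open_Borel_measurable.
  by apply: measurableC; exact: open_Borel_measurable.
exists (V, B); split => //=.
- move=> [x y] Exy; rewrite /V /= -bigcup_seq => -[z /= zD [/= Wx]]; apply.
  by have [_ _ _ _] := WUP z (DP z zD); apply; [exact: Wx|].
- rewrite measureD//; last by rewrite -ge0_fin_numE// fin_num_measure_setT.
  have BOE : O c `&` B = B by apply/setIidPr.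
  by rewrite BOE leeBlDr ?fin_num_measure_setT// addeC ltW.
- move=> x Bx; have [z zD Wzx] := BD _ Bx; have Bz := DP _ zD.
  have [oW _ oU lec _] := WUP z Bz; apply: le_trans (ltW lec).
  have VU : [set y | V (x, y)] `<=` (WU z).2.
    move=> y /= Vxy; apply: contrapT => nU; apply: Vxy; rewrite -bigcup_seq.
    by exists z.
  apply: le_measure => //; rewrite inE; last exact: open_Borel_measurable.
  by rewrite -xsection_setE; exact: measurable_xsection.
Qed.

(** The covers of [section_cover] are intersected over all thresholds [q k] and all errors
    [harmonic n]. Off a null set, every threshold above the section measure of [E] at [x] comes with
    some cover whose section at [x] is bounded by it. *)
Lemma section_hull : exists V : set (Borel X * Borel Y),
  [/\ measurable V, E `<=` V &
    {ae nu, forall x, mu [set y | V (x, y)] = mu [set y | E (x, y)]}].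
Proof.
have [q qP] := dense_seq.
have /choice[VB VBP] (kn : nat * nat) := section_cover (q kn.1) (harmonic_gt0 kn.2).
pose V := \bigcap_k \bigcap_n (VB (k, n)).1.
(* The exceptional points: for some threshold [q k] the section of [E] is smaller, yet no error
   level [n] controls the cover there. For fixed [k] this set has measure at most [harmonic n] for
   every [n], hence zero. *)
pose Z := \bigcup_k \bigcap_n (O (q k) `\` (VB (k, n)).2).
have mV : measurable V.
  apply: bigcapT_measurable => k; apply: bigcapT_measurable => n.
  by have [] := VBP (k, n).
have EV : E `<=` V.
  by move=> p Ep k _ n _; have [_ + _ _ _] := VBP (k, n); exact.
exists V; split => //; exists Z; split.
- apply: bigcupT_measurable => k; apply: bigcapT_measurable => n.
  by apply: measurableD => //; have [] := VBP (k, n).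
- apply/negligibleP.
    apply: bigcupT_measurable => k; apply: bigcapT_measurable => n.
    by apply: measurableD => //; have [] := VBP (k, n).
  apply: negligible_bigcup => k.
  have mZk : measurable (\bigcap_n (O (q k) `\` (VB (k, n)).2)).
    apply: bigcapT_measurable => n.
    by apply: measurableD => //; have [] := VBP (k, n).
  apply/negligibleP => //; apply/eqP; rewrite eq_le measure_ge0 andbT.
  apply/lee_addgt0Pr => e e0; rewrite add0e.
  have [n ltn] := filter_ex (near_infty_natSinv_lt (PosNum e0)).
  have [_ _ mB' le _] := VBP (k, n); apply: (@le_trans _ _ (harmonic n)%:E).
    apply: le_trans le; apply: le_measure; rewrite ?inE//.
      exact: measurableD.
    exact: bigcap_inf.
  by rewrite lee_fin ltW.
- move=> x /= xVE; apply: contrapT => nZ; apply: xVE.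
  have mVx : measurable ([set y | V (x, y)] : set (Borel Y)).
    by rewrite -xsection_setE; exact: measurable_xsection.
  apply/eqP; rewrite eq_le; apply/andP; split; last first.
    apply: le_measure; rewrite ?inE//; first exact: measurable_section.
    by move=> y; exact: EV.
  have fE := fin_num_measure_setT muT (measurable_section cE x).
  rewrite -(fineK fE); apply/lee_addgt0Pr => e e0.
  (* A threshold is picked strictly between the section measure and its increase by [e]. *)
  have := qP (fine (mu [set y | E (x, y)])) (fine (mu [set y | E (x, y)]) + e)%R.
  rewrite ltrDl => /(_ e0)[k /andP[ltk kle]]; rewrite -EFinD.
  apply: le_trans (_ : (q k)%:E <= _); last by rewrite lee_fin ltW.
  have [n VBx] : exists n, (VB (k, n)).2 x.
    apply: contrapT => /forallNP nVB; apply: nZ; exists k => // n _; split => //.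
    by rewrite /O /= -(fineK fE) lte_fin.
  have [mV' _ _ _ /(_ x VBx)] := VBP (k, n); apply: le_trans.
  apply: le_measure; rewrite ?inE//.
    by rewrite -xsection_setE; exact: measurable_xsection.
  by move=> y /= Vxy; exact: Vxy.
Qed.

(** Tonelli applies to the measurable hull [V]. Replacing [E] by [V] leaves the right side
    unchanged, by almost everywhere equality, and can only increase the left side. Exchanging the
    two factors then gives the reverse inequality. *)
Lemma closed_fubini_le :
  \int[mu]_y nu [set x | E (x, y)] <= \int[nu]_x mu [set y | E (x, y)].
Proof.
have [nu' nuE] := finite_measure_of nuT.
have [mu' muE] := finite_measure_of muT.
have [V [mV EV aeV]] := section_hull.
have mfV1 : measurable_fun [set: Borel X] (fun x => mu [set y | V (x, y)]).
  under eq_fun do rewrite -xsection_setE -muE.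
  exact: (measurable_fun_xsection mu' mV).
have mfV2 : measurable_fun [set: Borel Y] (fun y => nu [set x | V (x, y)]).
  under eq_fun do rewrite -ysection_setE -nuE.
  exact: (measurable_fun_ysection nu' mV).
have -> : \int[nu]_x mu [set y | E (x, y)] = \int[nu]_x mu [set y | V (x, y)].
  apply: ae_eq_integral => //; first exact: measurable_fun_section.
  by apply: filterS aeV => x -> _.
have -> : \int[nu]_x mu [set y | V (x, y)] = \int[mu]_y nu [set x | V (x, y)].
  rewrite -nuE -muE; under eq_integral do rewrite -xsection_setE.
  under [RHS]eq_integral do rewrite -ysection_setE.
  (* The two iterated integrals are two measures that agree on rectangles, hence on [V]. *)
  have := @product_measure_unique _ _ _ _ _ nu' mu'
    (product_measure2 nu' mu' : {measure set _ -> \bar R}) _ V mV.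
  by apply => A B mA mB; rewrite /= product_measure2E.
apply: ge0_le_integral => //.
  exact: (measurable_fun_section cX hX nuT rnu (closed_swap cE)).
move=> y _; apply: le_measure; rewrite ?inE.
- exact: (measurable_section (closed_swap cE)).
- by rewrite -ysection_setE; exact: measurable_ysection.
- by move=> x; exact: EV.
Qed.

End two_measures.

Lemma closed_fubini (X Y : ptopologicalType)
    (nu : {measure set (Borel X) -> \bar R})
    (mu : {measure set (Borel Y) -> \bar R}) (E : set (X * Y)) :
  compact [set: X] -> hausdorff_space X ->
  compact [set: Y] -> hausdorff_space Y ->
  nu setT < +oo -> inner_regular nu -> mu setT < +oo -> inner_regular mu ->
  closed E ->
  \int[nu]_x mu [set y | E (x, y)] = \int[mu]_y nu [set x | E (x, y)].
Proof.
move=> cX hX cY hY nuT rnu muT rmu cE; apply/eqP; rewrite eq_le.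
rewrite (closed_fubini_le cX hX cY hY nuT rnu muT rmu cE) andbT.
exact: (closed_fubini_le cY hY cX hX muT rmu nuT rnu (closed_swap cE)).
Qed.

End ClosedFubini.

(** * Measures given by a density, and image measures *)

Section Density.
Context {d} {X : measurableType d} {R : realType}.
Local Open Scope ereal_scope.
Import HBNNSimple.

Lemma density_measure (nu : {measure set X -> \bar R}) (phi : X -> \bar R) :
  measurable_fun setT phi -> (forall x, 0 <= phi x) ->
  exists la : {measure set X -> \bar R},
    forall A, la A = \int[nu]_(x in A) phi x.
Proof.
move=> mphi phi0; pose la A := \int[nu]_(x in A) phi x.
have la0 : la set0 = 0 by rewrite /la integral_set0.
have la_ge0 A : 0 <= la A by exact: integral_ge0.
have lasig : semi_sigma_additive la.
  move=> F mF tF mUF; rewrite /la.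
  rewrite ge0_integral_bigcup//; last exact: measurable_funTS.
  by apply: is_cvg_nneseries => n _ _; exact: integral_ge0.
exists (HB.pack_for (Measure.type X R) la
  (isMeasure.Build _ _ _ la la0 la_ge0 lasig)) => //.
Qed.

(** Checked term by term on simple functions, then extended by monotone convergence. The bound
    [phi x <= 1] makes [phi] finite, so that limits pass through the product with it. *)
Lemma ge0_integral_density (nu la : {measure set X -> \bar R})
    (phi f : X -> \bar R) :
  measurable_fun setT phi -> (forall x, 0 <= phi x <= 1) ->
  (forall A, measurable A -> la A = \int[nu]_(x in A) phi x) ->
  measurable_fun setT f -> (forall x, 0 <= f x) ->
  \int[la]_x f x = \int[nu]_x (f x * phi x).
Proof.
move=> mphi phi01 laE mf f0.
have phi0 x : 0 <= phi x by have /andP[] := phi01 x.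
have phifin x : phi x \is a fin_num.
  by rewrite ge0_fin_numE// (le_lt_trans _ (ltry 1))//; have /andP[] := phi01 x.
pose g := nnsfun_approx measurableT mf.
have glim x : EFin (g n x) @[n --> \oo] --> f x by exact: cvg_nnsfun_approx.
have gnd x m n : (m <= n)%N -> (g m x <= g n x)%R.
  by move=> mn; exact/lefP/nd_nnsfun_approx.
have -> : \int[la]_x f x = limn (fun n => \int[la]_x (g n x)%:E).
  rewrite -monotone_convergence//.
  - by apply: eq_integral => x _; apply/esym/cvg_lim => //; exact: glim.
  - by move=> n; exact/measurable_EFinP.
  - by move=> n x _; rewrite lee_fin.
  - by move=> x _ m n mn; rewrite lee_fin gnd.
have -> : \int[nu]_x (f x * phi x) =
    limn (fun n => \int[nu]_x ((g n x)%:E * phi x)).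
  rewrite -monotone_convergence//.
  - apply: eq_integral => x _; apply/esym/cvg_lim => //.
    by apply: cvgeZr => //; exact: glim.
  - by move=> n; apply: emeasurable_funM => //; exact/measurable_EFinP.
  - by move=> n x _; rewrite mule_ge0// lee_fin.
  - by move=> x _ m n mn; rewrite lee_wpmul2r// lee_fin gnd.
congr (limn _); apply/funext => n.
rewrite integralT_nnsfun sintegralE.
under [RHS]eq_integral => x _.
  rewrite fimfunE -fsumEFin// ge0_mule_fsuml; last first.
    by move=> r; exact: nnfun_muleindic_ge0.
  over.
rewrite ge0_integral_fsum//=.
- apply: eq_fsbigr => r rg; rewrite laE//.
  have r0 : (0 <= r)%R by move: rg; rewrite inE => -[x _ <-].
  under [RHS]eq_integral do rewrite EFinM -muleA.
  rewrite ge0_integralZl_EFin//.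
  + congr (_ * _); rewrite integral_mkcond epatch_indic.
    by apply: eq_integral => x _ /=; rewrite muleC.
  + by move=> x _; rewrite mule_ge0// lee_fin.
  + by apply: emeasurable_funM => //; exact/measurable_EFinP.
- move=> r; apply: emeasurable_funM => //; apply/measurable_EFinP.
  by apply: measurable_funM.
- by move=> r x _; rewrite mule_ge0// nnfun_muleindic_ge0.
Qed.

End Density.

Lemma pushforward_measure {d1 d2} {X : measurableType d1} {Y : measurableType d2}
    {R : realType} (mu : {measure set X -> \bar R}) (f : X -> Y) :
  measurable_fun setT f ->
  exists nu : {measure set Y -> \bar R}, forall A, nu A = mu (f @^-1` A).
Proof.
move=> mf; unshelve eexists (pushforward mu f); [exact: mf|by []].
Qed.

Section DensityRadon.
Context {R : realType}.
Local Open Scope ereal_scope.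

(** Since [phi] is at most 1, a compact [K] that nearly exhausts [A] for [nu] does so for [la] with
    the same error. *)
Lemma inner_regular_density (X : ptopologicalType)
  (nu la : {measure set (Borel X) -> \bar R}) (phi : Borel X -> \bar R) :
  hausdorff_space X ->
  nu setT < +oo -> inner_regular nu ->
  measurable_fun setT phi -> (forall x, 0 <= phi x <= 1) ->
  (forall A, measurable A -> la A = \int[nu]_(x in A) phi x) ->
  inner_regular la.
Proof.
move=> hX nuT rnu mphi phi01 laE; apply: inner_regular_intro => // A e mA e0.
have [K [cK KA lt]] := inner_approx nuT rnu mA e0.
have mK : measurable (K : set (Borel X)).
  by apply: closed_Borel_measurable; exact: compact_closed.
exists K; split => //.
rewrite -{1}(setDUK KA) measureU//; last 2 first.
- exact: measurableD.
- by rewrite setDIK.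
apply: leeD2l; rewrite [leLHS]laE; last exact: measurableD.
apply: (@le_trans _ _ (nu (A `\` K))).
  rewrite -[leRHS]mul1e -integral_cst; last exact: measurableD.
  apply: ge0_le_integral => //; first exact: measurableD.
  - by move=> x _; have /andP[] := phi01 x.
  - exact: measurable_funTS.
  - by move=> x _; have /andP[] := phi01 x.
rewrite measureD//; last by rewrite -ge0_fin_numE// fin_num_measure_setT.
have -> : A `&` K = K by apply/setIidPr.
by rewrite leeBlDr ?fin_num_measure_setT// addeC ltW.
Qed.

End DensityRadon.

(** * Algebra and topology of compact groups *)

Section GroupTheory.
Context {T : ptopologicalType} (G : compact_group T).
Local Notation "x * y" := (cg_mul G x y).
Local Notation "x ^-1" := (cg_inv G x).
Local Notation "1" := (cg_one G).

(** The axioms provide only a left unit and left inverses; multiplying on the left by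
    [x^-1^-1 * x^-1] reduces the claim to them. *)
Lemma cg_mulrV x : x * x^-1 = 1.
Proof.
rewrite -[LHS](cg_mul1 G) -{1}(cg_mulV G x^-1) -(cg_mulA G).
by rewrite (cg_mulA G x^-1) cg_mulV cg_mul1 cg_mulV.
Qed.

Lemma cg_mulr1 x : x * 1 = x.
Proof. by rewrite -(cg_mulV G x) cg_mulA cg_mulrV cg_mul1. Qed.

Lemma cg_mulKV x y : x * (x^-1 * y) = y.
Proof. by rewrite cg_mulA cg_mulrV cg_mul1. Qed.

Lemma cg_mulVK x y : x^-1 * (x * y) = y.
Proof. by rewrite cg_mulA cg_mulV cg_mul1. Qed.

Lemma cg_mulI x y z : x * y = x * z -> y = z.
Proof. by move=> e; rewrite -(cg_mulVK x y) e cg_mulVK. Qed.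

Lemma cg_invK x : x^-1^-1 = x.
Proof. by apply: (@cg_mulI x^-1); rewrite cg_mulrV cg_mulV. Qed.

Lemma cg_invM x y : (x * y)^-1 = y^-1 * x^-1.
Proof.
by apply: (@cg_mulI (x * y)); rewrite cg_mulrV -cg_mulA cg_mulKV cg_mulrV.
Qed.

Lemma gcomm1P x y : gcomm G x y = 1 <-> x * y = y * x.
Proof.
rewrite /gcomm; split => [e|->]; last by rewrite cg_mulVK cg_mulV.
apply: (@cg_mulI y^-1); rewrite cg_mulVK; apply: (@cg_mulI x^-1).
by rewrite e cg_mulV.
Qed.

Lemma gcommC x y : gcomm G x y = 1 <-> gcomm G y x = 1.
Proof. by rewrite !gcomm1P; split => ->. Qed.

Lemma centralizer_subgroup x : is_subgroup G [set y | gcomm G x y = 1].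
Proof.
split; last split => [y z|y] /=.
- by apply/gcomm1P; rewrite cg_mul1 cg_mulr1.
- move=> /gcomm1P xy /gcomm1P xz; apply/gcomm1P.
  by rewrite cg_mulA xy -cg_mulA xz cg_mulA.
- move=> /gcomm1P xy; apply/gcomm1P; apply: (@cg_mulI y).
  by rewrite cg_mulKV cg_mulA -xy -cg_mulA cg_mulrV cg_mulr1.
Qed.

Section continuity.
Variable S : topologicalType.
Implicit Types f g : S -> T.

(** The axiom concerns [p.1 * p.2^-1] only: inversion is recovered as division of [1], and
    multiplication afterwards as division by an inverse. *)
Lemma continuous_cg_inv f : continuous f -> continuous (fun s => (f s)^-1).
Proof.
move=> cf s.
have -> : (fun s => (f s)^-1) =
    (fun p : T * T => p.1 * p.2^-1) \o (fun s => (1, f s)).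
  by apply/funext => t /=; rewrite cg_mul1.
apply: continuous_comp; last exact: cg_cont.
by apply: cvg_pair; [exact: cvg_cst|exact: cf].
Qed.

Lemma continuous_cg_mul f g :
  continuous f -> continuous g -> continuous (fun s => f s * g s).
Proof.
move=> cf cg s.
have -> : (fun s => f s * g s) =
    (fun p : T * T => p.1 * p.2^-1) \o (fun s => (f s, (g s)^-1)).
  by apply/funext => t /=; rewrite cg_invK.
apply: continuous_comp; last exact: cg_cont.
by apply: cvg_pair; [exact: cf|exact: continuous_cg_inv].
Qed.

Lemma continuous_gcomm f g :
  continuous f -> continuous g -> continuous (fun s => gcomm G (f s) (g s)).
Proof.
by move=> cf cg; do 3 (apply: continuous_cg_mul; try exact: continuous_cg_inv).
Qed.

Lemma closed_continuous f (K : set T) :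
  continuous f -> closed K -> closed [set s | K (f s)].
Proof.
move=> cf cK.
by apply: (@preimage_closed _ _ f K) => // s _; exact: cf.
Qed.

End continuity.

Lemma cg_inv_continuous : continuous (cg_inv G).
Proof. by apply: (@continuous_cg_inv _ id) => x; exact: cvg_id. Qed.

Lemma cg_mul_continuous : continuous (fun p : T * T => p.1 * p.2).
Proof.
by apply: continuous_cg_mul => p; [exact: cvg_fst|exact: cvg_snd].
Qed.

Lemma cg_mulr_continuous h : continuous (fun x => x * h).
Proof.
by apply: continuous_cg_mul => x; [exact: cvg_id|exact: cvg_cst].
Qed.

Lemma closed_cg1 : closed [set 1].
Proof.
by apply: accessible_closed_set1; apply: hausdorff_accessible; exact: cg_hausdorff.
Qed.

(** The product set is the continuous image of a compact set in a Hausdorff space. *)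
Lemma closed_mul_set (A B : set T) :
  closed A -> closed B -> closed [set a * b | a in A & b in B].
Proof.
move=> cA cB; have cT := cg_compact G.
have -> : [set a * b | a in A & b in B] =
    (fun p : T * T => p.1 * p.2) @` (A `*` B).
  apply/seteqP; split => [_ [a Aa [b Bb <-]]|_ [[a b] [/= Aa Bb] <-]].
    by exists (a, b).
  by exists a => //; exists b.
apply: compact_closed; first exact: cg_hausdorff.
apply: continuous_compact.
  by apply: continuous_subspaceT; exact: cg_mul_continuous.
by apply: compact_setX; exact: (subclosed_compact _ cT).
Qed.

Lemma closed_centralizer x : closed [set y | gcomm G x y = 1].
Proof.
apply: (closed_continuous _ closed_cg1); apply: continuous_gcomm.
  by move=> ?; exact: cvg_cst.
by move=> ?; exact: cvg_id.
Qed.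

End GroupTheory.

(** * Haar measures of closed subgroups: uniqueness and two-sided invariance *)

Section HaarMeasure.
Context {R : realType} {T : ptopologicalType} (G : compact_group T).
Local Notation "x *g y" := (cg_mul G x y) (at level 40, left associativity).
Local Notation "x ^-g" := (cg_inv G x) (at level 3, left associativity).
Local Open Scope ereal_scope.
Implicit Types (mu nu : {measure set (Borel T) -> \bar R}) (H K : set T).

(** Both measures are suprema over compact sets, which are closed in a Hausdorff space. *)
Lemma eq_inner_regular mu nu : hausdorff_space T ->
  inner_regular mu -> inner_regular nu ->
  (forall K, closed K -> mu K = nu K) ->
  forall A, measurable A -> mu A = nu A.
Proof.
move=> hT rmu rnu e A mA; rewrite rmu// rnu//; congr ereal_sup.
apply/seteqP; split => _ [K [cK KA] <-]; exists K => //;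
  by rewrite e//; exact: compact_closed.
Qed.

Lemma ae_supported mu H (P : T -> Prop) : closed H ->
  mu (~` H) = 0 -> (forall x, H x -> P x) -> {ae mu, forall x, P x}.
Proof.
move=> cH mu0 HP; exists (~` H); split => //.
- by apply: measurableC; exact: closed_Borel_measurable.
- by move=> x /= nP /HP.
Qed.

(** The left side is the convolution of [nu] and [mu] at [K]. Integrating over [x] first, the inner
    measure is [nu K] for every [y] in [H], and [mu] vanishes off [H]. *)
Lemma convolution_right_invariant mu nu H K : closed H ->
  mu setT < +oo -> inner_regular mu -> mu (~` H) = 0 ->
  nu setT < +oo -> inner_regular nu ->
  (forall h, H h -> nu [set x | K (x *g h)] = nu K) -> closed K ->
  \int[nu]_x mu [set y | K (x *g y)] = nu K * mu setT.
Proof.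
move=> cH muT rmu muH nuT rnu nuR cK.
have hT := cg_hausdorff G; have cT := cg_compact G.
have cE : closed [set p : T * T | K (p.1 *g p.2)].
  exact: closed_continuous (@cg_mul_continuous _ G) cK.
rewrite (closed_fubini cT hT cT hT nuT rnu muT rmu cE) -integral_cst//=.
apply: ae_eq_integral => //.
  exact: (measurable_fun_section cT hT nuT rnu (closed_swap cE)).
by apply: (ae_supported cH muH) => h Hh _ /=; exact: nuR.
Qed.

Section haar_on.
Variables (H : set T) (mu : {measure set (Borel T) -> \bar R}).
Hypotheses (cH : closed H) (haar : haar_on G H mu).

Lemma haar_finite : mu setT < +oo.
Proof. by case: haar => -> _ _ _; rewrite ltry. Qed.

Lemma haar_inner_regular : inner_regular mu.
Proof. by case: haar. Qed.

Lemma haar_supported : mu (~` H) = 0.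
Proof.
case: haar => muT muH _ _; have mH := closed_Borel_measurable cH.
rewrite -setTD measureD// ?setTI; last exact: haar_finite.
by rewrite [X in X - _]muT [X in _ - X]muH subee.
Qed.

Lemma haar_left_invariant h (A : set (Borel T)) : H h -> measurable A ->
  is_subgroup G H -> mu [set x | A (h *g x)] = mu A.
Proof.
move=> Hh mA [_ [_ HV]]; case: haar => _ _ inv _.
rewrite -[RHS](inv (h^-g) A)//; last exact: HV.
congr (mu _); apply/seteqP; split => [x Ax|_ [x Ax <-]] /=.
  by exists (h *g x) => //; rewrite cg_mulVK.
by rewrite cg_mulKV.
Qed.

End haar_on.

(* Averaging [mu] over the right-invariant measure [nu^-1], in both orders. *)
Lemma haar_invE H mu nu K : closed_subgroup G H ->
  haar_on G H mu -> haar_on G H nu -> closed K ->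
  mu K = nu [set x | K x^-g].
Proof.
move=> [sH cH] hmu hnu cK; have hT := cg_hausdorff G.
have cinv := @cg_inv_continuous _ G.
(* The image of [nu] under inversion: left invariance of [nu] becomes right invariance of [nu']. *)
have [nu' nuE] :=
  pushforward_measure nu (continuous_Borel_measurable cinv).
have rnu' : inner_regular nu'.
  apply: (inner_regular_pushforward hT hT cinv (fun A _ => nuE A)).
    exact: haar_finite hnu.
  exact: haar_inner_regular hnu.
have [nuT1 _ _ _] := hnu; have [muT1 _ _ _] := hmu.
have nu'T : nu' setT = 1 by rewrite nuE preimage_setT.
have nu'H : nu' (~` H) = 0.
  rewrite nuE -(haar_supported cH hnu); congr (nu _).
  have [_ [_ HV]] := sH; apply/seteqP; split => x /= h /HV //.
  by rewrite cg_invK.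
have := @convolution_right_invariant mu nu' H K cH.
rewrite muT1 nu'T mule1 nuE => <- //; rewrite ?ltry//.
(* The other order of integration: for [x] in [H], left invariance of [mu] makes the inner measure
   equal to [mu K]. *)
- rewrite -[LHS]mule1 -nu'T -integral_cst//; apply: ae_eq_integral => //.
    apply: (@measurable_fun_section _ _ _ _ _ _ _ _ [set p : T * T | K (p.1 *g p.2)]).
    + exact: cg_compact.
    + exact: hT.
    + exact: haar_finite hmu.
    + exact: haar_inner_regular hmu.
    + exact: closed_continuous (@cg_mul_continuous _ G) cK.
  apply: (ae_supported cH nu'H) => h Hh _ /=.
  by rewrite (haar_left_invariant hmu Hh)//; exact: closed_Borel_measurable.
- exact: haar_inner_regular hmu.
- exact: haar_supported hmu.
- move=> h Hh; rewrite !nuE.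
  have [_ [_ HV]] := sH.
  rewrite -(haar_left_invariant hnu (HV _ Hh) (A := [set x | K x^-g]))//.
    by congr (nu _); apply/seteqP; split => x /=; rewrite cg_invM cg_invK.
  by apply: closed_Borel_measurable; exact: closed_continuous.
Qed.

(** On a closed [K], [haar_invE] identifies both [mu K] and [nu K] with the [nu]-measure of the
    inverse of [K]. *)
Lemma haar_unique H mu nu : closed_subgroup G H ->
  haar_on G H mu -> haar_on G H nu ->
  forall A, measurable A -> mu A = nu A.
Proof.
move=> sH hmu hnu; apply: eq_inner_regular.
- exact: cg_hausdorff.
- exact: haar_inner_regular hmu.
- exact: haar_inner_regular hnu.
- by move=> K cK; rewrite (haar_invE sH hmu hnu cK) -(haar_invE sH hnu hnu).
Qed.

(** Taking both measures equal in [haar_invE] gives invariance under inversion, which turns right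
    translation by [h] into left translation by its inverse. *)
Lemma haar_right_invariant H mu h : closed_subgroup G H ->
  haar_on G H mu -> H h ->
  forall A : set (Borel T), measurable A -> mu [set x | A (x *g h)] = mu A.
Proof.
move=> cH hmu Hh; have hT := cg_hausdorff G.
have cmul := @cg_mulr_continuous _ G h.
have [nu nuE] := pushforward_measure mu (continuous_Borel_measurable cmul).
have rnu : inner_regular nu.
  apply: (inner_regular_pushforward hT hT cmul (fun A _ => nuE A)).
    exact: haar_finite hmu.
  exact: haar_inner_regular hmu.
move=> A mA; rewrite -[LHS]nuE; apply: eq_inner_regular => //.
  exact: haar_inner_regular hmu.
move=> K cK; rewrite nuE (haar_invE cH hmu hmu cK).
rewrite (haar_invE cH hmu hmu (closed_continuous cmul cK)).
have [[_ [_ HV]] _] := cH.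
rewrite -(haar_left_invariant hmu (HV _ Hh) (A := [set x | K x^-g])).
- by congr (mu _); apply/seteqP; split => x /=; rewrite cg_invM cg_invK.
- apply: closed_Borel_measurable.
  exact: closed_continuous (@cg_inv_continuous _ G) cK.
- by case: cH.
Qed.

(* The fibre of [x *g n \in C] over [x] is a translate of [C `&` N] if [x] is in
   [C * N], and misses [N] otherwise. *)
Lemma subgroup_measureE (la muN : {measure set (Borel T) -> \bar R}) (N C : set T) :
  closed_subgroup G N -> haar_on G N muN -> closed_subgroup G C ->
  la setT < +oo -> inner_regular la ->
  (forall n K, N n -> closed K -> la [set x | K (x *g n)] = la K) ->
  la C = muN C * la [set c *g n | c in C & n in N].
Proof.
move=> [sN cN] hN [sC cC] laT rla laR.
have [NT1 _ _ _] := hN; have [N1 [NM NV]] := sN; have [C1 [CM CV]] := sC.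
pose CN := [set c *g n | c in C & n in N].
have cCN : closed CN by exact: closed_mul_set.
have mCN : measurable (CN : set (Borel T)) by exact: closed_Borel_measurable.
rewrite -[LHS]mule1 -NT1 -(@convolution_right_invariant muN la N C) //.
- rewrite (eq_integral (fun x => muN C * (\1_(CN : set (Borel T)) x)%:E)).
    rewrite ge0_integralZl//.
    + by rewrite integral_indic// setIT.
    + exact/measurable_EFinP.
  move=> x _; rewrite indicE; have [/set_mem xCN|xCN] := boolP (x \in CN).
    rewrite mule1; case: xCN => c Cc [n Nn <-].
    rewrite -[RHS](haar_left_invariant hN Nn)//; last exact: closed_Borel_measurable.
    congr (muN _); apply/seteqP; split => y /= Cy.
      by rewrite -(cg_mulVK G c (n *g y)); apply: CM; [exact: CV|rewrite cg_mulA].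
    by rewrite -cg_mulA; exact: CM.
  rewrite mule0; apply/eqP; rewrite eq_le measure_ge0 andbT.
  rewrite -(haar_supported cN hN); apply: le_measure; rewrite ?inE.
  + apply: closed_Borel_measurable.
    exact: (@closed_section T T _ x (closed_continuous (@cg_mul_continuous _ G) cC)).
  + by apply: measurableC; exact: closed_Borel_measurable.
  + move=> n /= Cxn Nn; move: xCN; rewrite notin_setE; apply.
    exists (x *g n) => //; exists n^-g; first exact: NV.
    by rewrite -cg_mulA cg_mulrV cg_mulr1.
- exact: haar_finite hN.
- exact: haar_inner_regular hN.
- exact: haar_supported hN.
- by move=> n Nn; exact: laR.
Qed.

End HaarMeasure.

(** * The quotient map and Haar measures of quotients *)

Section Quotient.
Context {R : realType} {T Q : ptopologicalType}.
Variables (G : compact_group T) (GQ : compact_group Q) (N : set T) (pi : T -> Q).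
Hypothesis quot : is_quotient_map G GQ N pi.
Local Open Scope ereal_scope.

Lemma quotient_map_inv x : pi (cg_inv G x) = cg_inv GQ (pi x).
Proof.
case: quot => _ _ _ piM _; apply: (@cg_mulI _ GQ (pi x)).
rewrite -piM !cg_mulrV; apply: (@cg_mulI _ GQ (pi (cg_one G))).
by rewrite -piM cg_mul1 cg_mulr1.
Qed.

Lemma quotient_map_gcomm x y : pi (gcomm G x y) = gcomm GQ (pi x) (pi y).
Proof. by case: quot => _ _ _ piM _; rewrite /gcomm !piM !quotient_map_inv. Qed.

Lemma quotient_map_image_closed_subgroup (H : set T) :
  closed_subgroup G H -> closed_subgroup GQ (pi @` H).
Proof.
case: quot => cpi _ _ piM _ [[H1 [HM HV]] cH].
have pi1 : pi (cg_one G) = cg_one GQ.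
  by apply: (@cg_mulI _ GQ (pi (cg_one G))); rewrite -piM cg_mul1 cg_mulr1.
split; [split; last split => [_ _ [x Hx <-] [y Hy <-]|_ [x Hx <-]]|].
- by exists (cg_one G).
- by exists (cg_mul G x y); [exact: HM|].
- exists (cg_inv G x); first exact: HV.
  exact: quotient_map_inv.
- apply: compact_closed; first exact: cg_hausdorff.
  apply: continuous_compact; first exact: continuous_subspaceT.
  by apply: subclosed_compact (cg_compact G) _.
Qed.

(** The image of [mu] under [pi] has all the properties required by [haar_on], so uniqueness
    applies. *)
Lemma haar_quotient (H : set T) (mu : {measure set (Borel T) -> \bar R})
    (nu : {measure set (Borel Q) -> \bar R}) :
  closed_subgroup G H -> haar_on G H mu -> haar_on GQ (pi @` H) nu ->
  forall A, measurable A -> nu A = mu (pi @^-1` A).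
Proof.
move=> sH hmu hnu A mA; case: (quot) => cpi _ _ piM _.
have [_ clH] := quotient_map_image_closed_subgroup sH.
have mpi := continuous_Borel_measurable cpi.
have [nu' nuE] := pushforward_measure mu mpi.
rewrite -nuE; apply: (haar_unique (quotient_map_image_closed_subgroup sH) hnu) => //.
have [muT muH muinv rmu] := hmu.
have mH : measurable (H : set (Borel T)).
  by apply: closed_Borel_measurable; case: sH.
have nuT : nu' setT = 1 by rewrite nuE preimage_setT.
split => //.
- apply/eqP; rewrite eq_le -{1}nuT; apply/andP; split.
    by apply: le_measure; rewrite ?inE//; exact: closed_Borel_measurable.
  rewrite nuE -muH; apply: le_measure; rewrite ?inE//.
    rewrite -[X in measurable X]setTI; apply: mpi => //.
    exact: closed_Borel_measurable.
  by move=> x Hx; exists x.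
- move=> _ B [h Hh <-] mB; rewrite !nuE -[RHS](muinv h)//; last first.
    by rewrite -[X in measurable X]setTI; exact: mpi.
  (* The preimage of the translate of [B] by [pi h] is the translate by [h] of the preimage of
     [B]. *)
  congr (mu _); apply/seteqP; split => [x [b Bb e]|_ [x Bx <-]] /=; last first.
    by exists (pi x).
  exists (cg_mul G (cg_inv G h) x); last by rewrite cg_mulKV.
  suff <- : b = pi (cg_mul G (cg_inv G h) x) by [].
  by apply: (@cg_mulI _ GQ (pi h)); rewrite e -piM cg_mulKV.
- apply: (inner_regular_pushforward _ _ cpi (fun A _ => nuE A)) => //.
  + exact: cg_hausdorff.
  + exact: cg_hausdorff.
  + exact: haar_finite hmu.
Qed.

End Quotient.

(** * Commutativity degrees: the inequality and the equality case *)

Lemma rel_comm_degreeE {R : realType} {T : ptopologicalType} (G : compact_group T)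
    (mu nu : {measure set (Borel T) -> \bar R}) :
  rel_comm_degree G mu nu =
  (\int[mu]_x nu [set y | gcomm G x y = cg_one G])%E.
Proof.
(* The product measure is by definition the integral of section measures, which makes sense for the
   commuting set even if it is not product measurable. *)
by apply: eq_integral => x _ /=; rewrite xsection_setE.
Qed.

Unset Implicit Arguments.

Theorem theorem2p11 (R : realType) (T : ptopologicalType) (G : compact_group T)
    (H N : set T)
    (Q : ptopologicalType) (GQ : compact_group Q) (pi : T -> Q)
    (muG muH muN : {measure set (Borel T) -> \bar R})
    (muGN muHN : {measure set (Borel Q) -> \bar R}) :
  closed_subgroup G H -> closed_subgroup G N ->
  N `<=` H -> normal_subgroup G N ->
  is_quotient_map G GQ N pi ->
  haar_on G [set: T] muG -> haar_on G H muH -> haar_on G N muN ->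
  haar_on GQ [set: Q] muGN -> haar_on GQ (pi @` H) muHN ->
  ((rel_comm_degree G muH muG
      <= rel_comm_degree GQ muHN muGN * rel_comm_degree G muN muN)%E /\
   (N `&` comm_subgroup G H [set: T] = [set cg_one G] ->
    rel_comm_degree G muH muG
      = (rel_comm_degree GQ muHN muGN * rel_comm_degree G muN muN)%E)).
Proof.
move=> sH sN NH nN quot hG hH hN hGN hHN.
have [cpi _ surj piM piker] := quot.
have cT := cg_compact G; have hT := cg_hausdorff G.
have cQ := cg_compact GQ; have hQ := cg_hausdorff GQ.
have [cH cN] := (sH.2, sN.2).
have sG : closed_subgroup G [set: T] by split; [split|exact: closedT].
(* The whole group [Q] is rewritten as the image of [G], so that [haar_quotient] also applies to
   [muG]. *)
have hGN' : haar_on GQ (pi @` [set: T]) muGN.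
  rewrite (_ : pi @` _ = setT)//; apply/seteqP; split => // q _.
  by have [x <-] := surj q; exists x.
pose C x := [set y | gcomm G x y = cg_one G].
have sC x : closed_subgroup G (C x).
  by split; [exact: centralizer_subgroup|exact: closed_centralizer].
have mC x : measurable (C x : set (Borel T)).
  by apply: closed_Borel_measurable; exact: closed_centralizer.
have cE : closed [set p : T * T | C p.1 p.2].
  apply: (closed_continuous _ (@closed_cg1 _ G)); apply: continuous_gcomm => p.
    exact: cvg_fst.
  exact: cvg_snd.
have cEQ : closed [set p : Q * Q | gcomm GQ p.1 p.2 = cg_one GQ].
  apply: (closed_continuous _ (@closed_cg1 _ GQ)); apply: continuous_gcomm => p.
    exact: cvg_fst.
  exact: cvg_snd.
pose CQ q := [set r | gcomm GQ q r = cg_one GQ].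
have mCQ q : measurable (CQ q : set (Borel Q)).
  by apply: closed_Borel_measurable; exact: closed_centralizer.
pose g (q : Borel Q) := muGN (CQ q).
have mg : measurable_fun setT g.
  apply: (measurable_fun_section cQ hQ _ _ cEQ).
    exact: haar_finite hGN.
  exact: haar_inner_regular hGN.
have mpi := continuous_Borel_measurable cpi.
pose phi (x : Borel T) := g (pi x).
have mphi : measurable_fun setT phi by exact: measurableT_comp mg mpi.
have phi01 x : (0 <= phi x <= 1)%E.
  rewrite measure_ge0/=; have [<- _ _ _] := hGN.
  by apply: le_measure; rewrite ?inE.
have phi0 x : (0 <= phi x)%E by have /andP[] := phi01 x.
have [la laE] := density_measure muH mphi phi0.
have laT : (la setT < +oo)%E.
  apply: le_lt_trans (haar_finite hH).
  rewrite laE -[leRHS]mul1e -integral_cst//; apply: ge0_le_integral => //.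
  by move=> x _; have /andP[] := phi01 x.
have rla : inner_regular la.
  apply: (inner_regular_density hT _ _ mphi phi01 (fun A _ => laE A)).
    exact: haar_finite hH.
  exact: haar_inner_regular hH.
(* [phi] is constant on cosets of [N], the kernel of [pi], and [muH] is right invariant under [N]
   because [N] lies in [H]. *)
have laR n K : N n -> closed K -> la [set x | K (cg_mul G x n)] = la K.
  move=> Nn cK; rewrite !laE; have mK := closed_Borel_measurable cK.
  have mR := continuous_Borel_measurable (@cg_mulr_continuous _ G n).
  pose rmul : Borel T -> Borel T := (cg_mul G)^~ n.
  transitivity (\int[pushforward muH rmul]_(y in K) phi y)%E.
    rewrite (ge0_integral_pushforward (mR : measurable_fun setT rmul))//.
      by apply: eq_integral => x _ /=; rewrite /phi piM ((piker n).2 Nn) cg_mulr1.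
    exact: measurable_funTS.
  apply: eq_measure_integral => A mA _.
  by apply: (haar_right_invariant sH hH) => //; exact: NH.
have laTE : la setT = rel_comm_degree GQ muHN muGN.
  rewrite rel_comm_degreeE laE -[RHS]/(\int[muHN]_q g q)%E.
  transitivity (\int[pushforward muH (pi : Borel T -> Borel Q)]_q g q)%E.
    by rewrite (ge0_integral_pushforward mpi).
  apply: eq_measure_integral => A mA _.
  by rewrite (haar_quotient quot sH hH hHN).
pose CN x := [set cg_mul G c n | c in C x & n in N].
have mCN x : measurable (CN x : set (Borel T)).
  apply: closed_Borel_measurable; apply: closed_mul_set => //.
  exact: closed_centralizer.
have muGC x : muG (C x) = (muN (C x) * muG (CN x))%E.
  apply: subgroup_measureE => //.
  - exact: haar_finite hG.
  - exact: haar_inner_regular hG.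
  - move=> n K Nn cK; apply: (haar_right_invariant sG hG) => //.
    exact: closed_Borel_measurable.
have laC m : la (C m) = (muN (C m) * la (CN m))%E.
  exact: subgroup_measureE.
have sub x : CN x `<=` pi @^-1` CQ (pi x).
  move=> _ [c /gcomm1P xc [n Nn <-]]; apply/gcomm1P.
  by rewrite piM ((piker n).2 Nn) cg_mulr1 -!piM xc.
have phiE x : phi x = muG (pi @^-1` CQ (pi x)) by exact: (haar_quotient quot sG hG hGN').
have mCfun : measurable_fun [set: Borel T] (fun x => muN (C x)).
  apply: (measurable_fun_section cT hT _ _ cE).
    exact: haar_finite hN.
  exact: haar_inner_regular hN.
have mCfunG : measurable_fun [set: Borel T] (fun x => muG (C x)).
  apply: (measurable_fun_section cT hT _ _ cE).
    exact: haar_finite hG.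
  exact: haar_inner_regular hG.
have mpre x : measurable (pi @^-1` CQ (pi x) : set (Borel T)).
  by rewrite -[X in measurable X]setTI; exact: mpi.
have swap : (\int[muH]_x (muN (C x) * phi x) = \int[muN]_m la (C m))%E.
  rewrite -(ge0_integral_density mphi phi01 (fun A _ => laE A))//.
  rewrite (closed_fubini cT hT cT hT laT rla _ _ cE).
  - apply: eq_integral => m _; congr (la _).
    by apply/seteqP; split => x /gcommC.
  - exact: haar_finite hN.
  - exact: haar_inner_regular hN.
have rhsE : (rel_comm_degree GQ muHN muGN * rel_comm_degree G muN muN =
    \int[muN]_m (la setT * muN (C m)))%E.
  by rewrite -laTE rel_comm_degreeE ge0_integralZl.
have mlaC : measurable_fun [set: Borel T] (fun m => la (C m)).
  exact: (measurable_fun_section cT hT laT rla cE).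
have mprod : measurable_fun [set: Borel T] (fun x => muN (C x) * phi x)%E.
  exact: emeasurable_funM.
have mprod2 : measurable_fun [set: Borel T] (fun x => la setT * muN (C x))%E.
  exact: emeasurable_funM.
rewrite rhsE rel_comm_degreeE; split => [|triv].
  apply: (@le_trans _ _ (\int[muH]_x (muN (C x) * phi x))%E).
    apply: ge0_le_integral => //.
    move=> x _; rewrite -/(C x) muGC phiE; apply: lee_wpmul2l => //.
    by apply: le_measure; rewrite ?inE//; exact: sub.
  rewrite swap; apply: ge0_le_integral => //.
  move=> m _; rewrite laC muleC; apply: lee_wpmul2r => //.
  by apply: le_measure; rewrite ?inE.
(* A commutator with first entry in [H] is a generator of [[H, G]]; if it also lies in [N], the
   trivial intersection kills it. *)
have comm h x : H h -> N (gcomm G h x) -> gcomm G h x = cg_one G.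
  move=> Hh Nhx; suff : (N `&` comm_subgroup G H setT) (gcomm G h x) by rewrite triv.
  by split => // K [_]; apply; exists h => //; exists x.
transitivity (\int[muH]_x (muN (C x) * phi x))%E.
  apply: ae_eq_integral => //.
  apply: (ae_supported cH (haar_supported cH hH)) => x Hx _.
  (* If [pi y] commutes with [pi x], the commutator of [x] and [y] lies in [N], hence is trivial; so
     [CN x] is the full preimage. *)
  rewrite -/(C x) muGC phiE; congr (_ * muG _)%E.
  apply/seteqP; split => [|y /= xy]; first exact: sub.
  exists y; last by exists (cg_one G); [case: sN => -[]|rewrite cg_mulr1].
  by apply: comm => //; apply/piker; rewrite (quotient_map_gcomm quot).
rewrite swap; apply: ae_eq_integral => //.
apply: (ae_supported cN (haar_supported cN hN)) => m Nm _.
rewrite laC muleC; congr (_ * _)%E.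
(* By normality the commutator of [h] and [m] is a product of two elements of [N], a conjugate of
   the inverse of [m] and [m] itself. It is therefore trivial, and [H] centralizes [N]. *)
have HC : H `<=` CN m.
  move=> h Hh; exists h; last by exists (cg_one G); [case: sN => -[]|rewrite cg_mulr1].
  apply/gcommC; apply: comm => //.
  have -> : gcomm G h m =
      cg_mul G (cg_mul G (cg_inv G h) (cg_mul G (cg_inv G m) h)) m.
    by rewrite /gcomm !cg_mulA.
  have [[_ [NM NV]] _] := sN; apply: NM => //; apply: nN.2; exact: NV.
(* Since [la] has a density with respect to [muH], which is concentrated on [H], the inclusion of
   [H] in [CN m] gives [CN m] full [la]-measure. *)
have muHCN : muH (~` CN m) = 0%E.
  apply/eqP; rewrite eq_le measure_ge0 andbT -(haar_supported cH hH).
  apply: le_measure; rewrite ?inE; last exact: subsetC.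
    exact: measurableC.
  by apply: measurableC; exact: closed_Borel_measurable.
have laCN : la (~` CN m) = 0%E.
  rewrite laE; apply: null_set_integral => //; first exact: measurableC.
  exact: measurable_funTS.
rewrite -(setUv (CN m)) measureU//; last 2 first.
- exact: measurableC.
- by rewrite setICr.
by rewrite [X in (_ + X)%E]laCN adde0.
Qed.
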